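(* Let $m,n\ge 1$, let $f,g\in\mathcal{O}_M^{(m)}$ and let $v,w\in\mathcal{S}(\mathbb{R}^m,\mathcal{S}_n')$ be Schwartz families. Then: 1) $(f+g)v=fv+gv$, $f(v+w)=fv+fw$ and $1_m v=v$, where $1_m$ is the constant function on $\mathbb{R}^m$ with value $1$; 2) the map $\Phi:\mathcal{O}_M^{(m)}\times\mathcal{S}(\mathbb{R}^m,\mathcal{S}_n')\to\mathcal{S}(\mathbb{R}^m,\mathcal{S}_n')$, $(f,v)\mapsto fv$, is a bilinear map.
   Context: Let $\mathbb{K}$ be $\mathbb{R}$ or $\mathbb{C}$. $\mathcal{S}_n=\mathcal{S}(\mathbb{R}^n,\mathbb{K})$ is the Schwartz space with its usual topology, and $\mathcal{S}_n'$ is its topological dual. $\mathcal{O}_M^{(m)}$ is the space of all $f\in C^\infty(\mathbb{R}^m,\mathbb{K})$ such that $\phi f\in\mathcal{S}_m$ for every $\phi\in\mathcal{S}_m$. $\mathcal{S}(\mathbb{R}^m,\mathcal{S}_n')$ is the space of Schwartz families: families $v=(v_p)_{p\in\mathbb{R}^m}$ in $\mathcal{S}_n'$ such that for every $\phi\in\mathcal{S}_n$ the function $p\mapsto v_p(\phi)$ belongs to $\mathcal{S}_m$; it is a $\mathbb{K}$-vector space under pointwise operations. The product of a Schwartz family $v$ by a function $f$ is the family $fv:=(f(p)v_p)_{p\in\mathbb{R}^m}$. Bilinear means $\mathbb{K}$-bilinear. *)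

(* Defs.v *)
From HB Require Import structures.
From mathcomp Require Import all_boot all_order all_algebra.
From mathcomp Require Import sesquilinear complex.
From mathcomp Require Import boolp classical_sets functions reals.
From mathcomp Require Import topology tvs normedtype derive.

Set Implicit Arguments.
Unset Strict Implicit.
Unset Printing Implicit Defensive.

Import Order.TTheory GRing.Theory Num.Theory.
Import numFieldNormedType.Exports.

Local Open Scope classical_set_scope.
Local Open Scope ring_scope.

(* The field K of scalars is R or C; both are numFieldType's, hence normed
   modules over themselves. In R[i] the norm takes its values in R[i], so real
   bounds are compared with it through [of_real]. *)
Variant scalar_kind := RealScalars | ComplexScalars.

Definition scalars (R : realType) (k : scalar_kind) : numFieldType :=
  match k with
  | RealScalars => R
  | ComplexScalars => R[i]
  end.

Definition of_real (R : realType) (k : scalar_kind) : R -> scalars R k :=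
  match k return R -> scalars R k with
  | RealScalars => fun x => x
  | ComplexScalars => @real_complex R
  end.
Arguments of_real {R} k x.

Section OfReal.
Context {R : realType} {k : scalar_kind}.

Lemma of_real_zmod_morphism : zmod_morphism (@of_real R k).
Proof. by case: k => //= x y; rewrite rmorphB. Qed.

Lemma of_real_monoid_morphism : monoid_morphism (@of_real R k).
Proof. by case: k => //=; split=> [|x y]; rewrite ?rmorph1 ?rmorphM. Qed.

HB.instance Definition _ :=
  GRing.isZmodMorphism.Build R (scalars R k) (of_real k) of_real_zmod_morphism.
HB.instance Definition _ :=
  GRing.isMonoidMorphism.Build R (scalars R k) (of_real k)
    of_real_monoid_morphism.

Lemma ler_of_real (x y : R) : (of_real k x <= of_real k y) = (x <= y).
Proof. by case: k => //=; rewrite lecR. Qed.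

End OfReal.

Section PartialDerivatives.
Context {R : realType} {k : scalar_kind} {n : nat}.
Local Notation K := (scalars R k).
Implicit Types (f g : 'rV[R]_n -> K) (x : 'rV[R]_n) (i : 'I_n).

(* The library's ['D_v f] needs a codomain normed over R, which R[i] is not;
   this is the same limit, with the real increment h embedded in K. *)
Definition diff_quotient i f x (h : R) : K :=
  (of_real k h)^-1 * (f (h *: delta_mx 0 i + x) - f x).

Definition pderivable i f x := cvg (diff_quotient i f x h @[h --> 0^']).

Definition pderiv i f x : K := lim (diff_quotient i f x h @[h --> 0^']).

Definition pderivs (s : seq 'I_n) f := foldr pderiv f s.

Definition smooth f := forall s : seq 'I_n,
  continuous (pderivs s f) /\ forall i x, pderivable i (pderivs s f) x.

Definition multi_index := {ffun 'I_n -> nat}.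

Definition monomial (b : multi_index) x : R := \prod_i x 0 i ^+ b i.

(* d_0^(a 0) (d_1^(a 1) (... f)); on smooth functions the order of the partial
   derivatives is immaterial. *)
Definition mpderiv (a : multi_index) f :=
  foldr (fun i => iter (a i) (pderiv i)) f (enum 'I_n).

(* x |-> x^b (d^a f)(x) *)
Definition weighted (a b : multi_index) f x : K :=
  of_real k (monomial b x) * mpderiv a f x.

Definition is_schwartz f := smooth f /\
  forall a b : multi_index,
    exists M : R, forall x, `|weighted a b f x| <= of_real k M.

End PartialDerivatives.

Arguments multi_index n : clear implicits.

Lemma pderivableE (R : realType) n i (f : 'rV[R]_n -> scalars R RealScalars) :
  pderivable i f = derivable (f : 'rV[R]_n -> R) ^~ (delta_mx 0 i).
Proof. by []. Qed.

Lemma pderivE (R : realType) n i (f : 'rV[R]_n -> scalars R RealScalars) :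
  pderiv i f = 'D_(delta_mx 0 i) (f : 'rV[R]_n -> R).
Proof. by []. Qed.

Section Closure.
Context {R : realType} {k : scalar_kind} {n : nat}.
Local Notation K := (scalars R k).
Implicit Types (f g : 'rV[R]_n -> K) (x : 'rV[R]_n) (i : 'I_n) (c : K).

Lemma diff_quotient_lin i f g x c :
  diff_quotient i (c *: f + g) x
  = c *: diff_quotient i f x + diff_quotient i g x.
Proof.
apply/funext => h; rewrite /diff_quotient /= !fctE.
rewrite /GRing.scale /= /GRing.scale /=.
set u := f _; set v := f x; set u' := g _; set v' := g x; set j := _^-1.
by rewrite opprD addrACA -mulrBr mulrDr mulrCA.
Qed.

Lemma cvg_diff_quotient_lin i f g x c :
  pderivable i f x -> pderivable i g x ->
  diff_quotient i (c *: f + g) x h @[h --> 0^']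
    --> c *: pderiv i f x + pderiv i g x.
Proof.
move=> cf cg; rewrite diff_quotient_lin.
by apply: cvgD => //; apply: cvgZl_tmp.
Qed.

Lemma pderivable_lin i f g x c : pderivable i f x -> pderivable i g x ->
  pderivable i (c *: f + g) x.
Proof.
move=> cf cg; apply/cvg_ex.
by exists (c *: pderiv i f x + pderiv i g x); exact: cvg_diff_quotient_lin.
Qed.

Lemma pderiv_lin i f g x c : pderivable i f x -> pderivable i g x ->
  pderiv i (c *: f + g) x = c *: pderiv i f x + pderiv i g x.
Proof.
move=> cf cg; apply: cvg_lim; first exact: norm_hausdorff.
exact: cvg_diff_quotient_lin.
Qed.

Lemma pderivs_lin s f g c : smooth f -> smooth g ->
  pderivs s (c *: f + g) = c *: pderivs s f + pderivs s g.
Proof.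
move=> sf sg; elim: s => //= i s ->; apply/funext => x.
by rewrite pderiv_lin//; [exact: (sf s).2|exact: (sg s).2].
Qed.

Lemma smooth_lin f g c : smooth f -> smooth g -> smooth (c *: f + g).
Proof.
move=> sf sg s; rewrite pderivs_lin//; split=> [x|i x].
  have cf : pderivs s f y @[y --> x] --> pderivs s f x by exact: (sf s).1.
  have cg : pderivs s g y @[y --> x] --> pderivs s g x by exact: (sg s).1.
  exact: (cvgD (cvgZl_tmp cf) cg).
by apply: pderivable_lin; [exact: (sf s).2|exact: (sg s).2].
Qed.

Lemma diff_quotient0 i x : diff_quotient i (0 : 'rV[R]_n -> K) x = fun=> 0.
Proof. by apply/funext => h; rewrite /diff_quotient /= subrr mulr0. Qed.

Lemma pderivs0 s : pderivs s (0 : 'rV[R]_n -> K) = 0.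
Proof.
elim: s => //= i s ->; apply/funext => x.
rewrite /pderiv diff_quotient0.
by apply: cvg_lim; [exact: norm_hausdorff|exact: cvg_cst].
Qed.

Lemma smooth0 : smooth (0 : 'rV[R]_n -> K).
Proof.
move=> s; rewrite pderivs0; split=> [|i x]; first exact: cst_continuous.
by rewrite /pderivable diff_quotient0; exact: is_cvg_cst.
Qed.

Lemma mpderivE (a : multi_index n) f :
  mpderiv a f = pderivs (flatten [seq nseq (a i) i | i <- enum 'I_n]) f.
Proof.
rewrite /mpderiv /pderivs; elim: (enum _) => //= i s ->.
by rewrite foldr_cat; elim: (a i) => //= m ->.
Qed.

Lemma weighted_lin a b f g x c : smooth f -> smooth g ->
  weighted a b (c *: f + g) x = c * weighted a b f x + weighted a b g x.
Proof.
move=> sf sg; rewrite /weighted !mpderivE pderivs_lin// !fctE.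
by rewrite mulrDr [RHS]addrC [LHS]addrC; congr (_ + _); rewrite mulrCA.
Qed.

Lemma weighted0 a b x : weighted a b (0 : 'rV[R]_n -> K) x = 0.
Proof. by rewrite /weighted mpderivE pderivs0 mulr0. Qed.

Lemma is_schwartz0 : is_schwartz (0 : 'rV[R]_n -> K).
Proof.
split=> [|a b]; first exact: smooth0.
by exists 0 => x; rewrite weighted0 normr0 rmorph0.
Qed.

Lemma norm_of_real_bound c : exists M : R, `|c| <= of_real k M.
Proof.
case: k c => /= c; first by exists `|c|.
by exists (complex.Re `|c|); rewrite normc_def /= lexx.
Qed.

Lemma is_schwartz_lin f g c :
  is_schwartz f -> is_schwartz g -> is_schwartz (c *: f + g).
Proof.
move=> [sf bf] [sg bg]; split=> [|a b]; first exact: smooth_lin.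
have [M fM] := bf a b; have [N gN] := bg a b.
have [C cC] := norm_of_real_bound c.
exists (C * M + N) => x; rewrite weighted_lin// rmorphD rmorphM /=.
apply: (le_trans (ler_normD _ _)); rewrite lerD// normrM ler_pM//.
Qed.

End Closure.

Section SchwartzSpace.
Context (R : realType) (k : scalar_kind) (n : nat).
Local Notation K := (scalars R k).

Definition schwartz_pred : {pred 'rV[R]_n -> K} :=
  fun f => `[< is_schwartz f >].

Lemma schwartz_submod_closed : submod_closed schwartz_pred.
Proof.
split=> [|c f g /asboolP sf /asboolP sg]; apply/asboolP.
  exact: is_schwartz0.
exact: is_schwartz_lin.
Qed.

HB.instance Definition _ :=
  GRing.isSubmodClosed.Build K _ schwartz_pred schwartz_submod_closed.

Record schwartz := Schwartz {
  schwartz_fun :> 'rV[R]_n -> K;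
  _ : schwartz_fun \in schwartz_pred }.

HB.instance Definition _ := [isSub for schwartz_fun].
HB.instance Definition _ := [Choice of schwartz by <:].
HB.instance Definition _ := [SubChoice_isSubLmodule of schwartz by <:].

Lemma schwartzP (phi : schwartz) : is_schwartz phi.
Proof. by case: phi => f /= /asboolP. Qed.

(* The seminorm sup_x |x^b (d^a phi)(x)| of (psi - phi) is at most e for all the
   pairs (a, b) in s. *)
Definition schwartz_ball (phi : schwartz)
    (s : seq (multi_index n * multi_index n)) (e : R) : set schwartz :=
  [set psi | forall ab, ab \in s ->
     forall x, `|weighted ab.1 ab.2 (psi - phi) x| <= of_real k e].

Definition schwartz_nbhs (phi : schwartz) : set_system schwartz :=
  filter_from [set se : seq (multi_index n * multi_index n) * R | 0 < se.2]
    (fun se => schwartz_ball phi se.1 se.2).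

HB.instance Definition _ := hasNbhs.Build schwartz schwartz_nbhs.

Lemma schwartz_ball_center phi s e : 0 < e -> schwartz_ball phi s e phi.
Proof.
move=> e0 ab _ x; rewrite subrr weighted0 normr0.
by rewrite -(rmorph0 (of_real k)) ler_of_real ltW.
Qed.

Lemma schwartz_nbhs_filter (phi : schwartz) : ProperFilter (nbhs phi).
Proof.
apply: filter_from_proper; last first.
  by move=> [s e] /= e0; exists phi; exact: schwartz_ball_center.
apply: filter_from_filter; first by exists ([::], 1) => /=.
move=> [s d] [t e] /= d0 e0; exists (s ++ t, Num.min d e).
  by rewrite /= lt_min d0.
move=> psi /= B; split=> ab abs x; (apply: le_trans;
  [by apply: B; rewrite mem_cat abs ?orbT|]);
  by rewrite ler_of_real ge_min lexx ?orbT.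
Qed.

Lemma schwartz_nbhs_singleton (phi : schwartz) (A : set schwartz) : nbhs phi A -> A phi.
Proof. by move=> [[s e] /= e0]; apply; exact: schwartz_ball_center. Qed.

Lemma schwartz_nbhs_nbhs (phi : schwartz) (A : set schwartz) :
  nbhs phi A -> nbhs phi (nbhs^~ A).
Proof.
move=> [[s e] /= e0 sA]; exists (s, e / 2); first by rewrite /= divr_gt0.
move=> psi /= B; exists (s, e / 2); first by rewrite /= divr_gt0.
move=> xi /= C; apply: sA => ab abs x.
have -> : (xi - phi : schwartz) = 1 *: (xi - psi) + (psi - phi).
  by rewrite scale1r addrA subrK.
rewrite [X in weighted _ _ X]/= weighted_lin ?mul1r; last 2 first.
- exact: (schwartzP (xi - psi)).1.
- exact: (schwartzP (psi - phi)).1.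
rewrite (splitr e) rmorphD; apply: (le_trans (ler_normD _ _)).
by apply: lerD; [exact: C|exact: B].
Qed.

HB.instance Definition _ := Nbhs_isNbhsTopological.Build schwartz
  schwartz_nbhs_filter schwartz_nbhs_singleton schwartz_nbhs_nbhs.

End SchwartzSpace.

Section DualSpace.
Context (R : realType) (k : scalar_kind) (n : nat).
Local Notation K := (scalars R k).
Local Notation S := (schwartz R k n).

Definition schwartz_dual_pred : {pred S -> K} :=
  fun u => `[< scalar u /\ continuous u >].

Lemma schwartz_dual_submod_closed : submod_closed schwartz_dual_pred.
Proof.
split=> [|c u v /asboolP[lu cu] /asboolP[lv cv]]; apply/asboolP; split.
- by move=> a x y /=; rewrite mulr0 addr0.
- exact: cst_continuous.
- move=> a x y; rewrite !fctE lu lv scalerDr addrACA mulrDr; congr (_ + _ + _).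
  exact: mulrCA.
- move=> x; have cux : u y @[y --> x] --> u x by exact: cu.
  have cvx : v y @[y --> x] --> v x by exact: cv.
  exact: (cvgD (cvgZl_tmp cux) cvx).
Qed.

HB.instance Definition _ := GRing.isSubmodClosed.Build K _ schwartz_dual_pred
  schwartz_dual_submod_closed.

Record schwartz_dual := SchwartzDual {
  schwartz_dual_fun :> S -> K;
  _ : schwartz_dual_fun \in schwartz_dual_pred }.

HB.instance Definition _ := [isSub for schwartz_dual_fun].
HB.instance Definition _ := [Choice of schwartz_dual by <:].
HB.instance Definition _ := [SubChoice_isSubLmodule of schwartz_dual by <:].

End DualSpace.

Section Multipliers.
Context (R : realType) (k : scalar_kind) (m : nat).
Local Notation K := (scalars R k).

Definition OM_pred : {pred 'rV[R]_m -> K} := fun f =>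
  `[< smooth f /\ forall phi : schwartz R k m, is_schwartz (phi \* f) >].

Lemma OM_submod_closed : submod_closed OM_pred.
Proof.
split=> [|c f g /asboolP[sf Sf] /asboolP[sg Sg]]; apply/asboolP; split.
- exact: smooth0.
- move=> phi; rewrite (_ : _ \* _ = 0); first exact: is_schwartz0.
  by apply/funext => x /=; rewrite mulr0.
- exact: smooth_lin.
- move=> phi; rewrite (_ : _ \* _ = c *: (phi \* f) + (phi \* g)).
    exact: is_schwartz_lin.
  by apply/funext => x /=; rewrite !fctE mulrDr; congr (_ + _); exact: mulrCA.
Qed.

HB.instance Definition _ :=
  GRing.isSubmodClosed.Build K _ OM_pred OM_submod_closed.

Record OM := MkOM {
  OM_fun :> 'rV[R]_m -> K;
  _ : OM_fun \in OM_pred }.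

HB.instance Definition _ := [isSub for OM_fun].
HB.instance Definition _ := [Choice of OM by <:].
HB.instance Definition _ := [SubChoice_isSubLmodule of OM by <:].

End Multipliers.

Section SchwartzFamilies.
Context (R : realType) (k : scalar_kind) (m n : nat).
Local Notation K := (scalars R k).
Local Notation S' := (schwartz_dual R k n).

Definition schwartz_family_pred : {pred 'rV[R]_m -> S'} := fun v =>
  `[< forall phi : schwartz R k n, is_schwartz (fun p => v p phi) >].

Lemma schwartz_family_submod_closed : submod_closed schwartz_family_pred.
Proof.
split=> [|c v w /asboolP Sv /asboolP Sw]; apply/asboolP => phi.
  exact: is_schwartz0.
exact: (is_schwartz_lin c (Sv phi) (Sw phi)).
Qed.

HB.instance Definition _ := GRing.isSubmodClosed.Build K _ schwartz_family_pred
  schwartz_family_submod_closed.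

Record schwartz_family := SchwartzFamily {
  schwartz_family_fun :> 'rV[R]_m -> S';
  _ : schwartz_family_fun \in schwartz_family_pred }.

HB.instance Definition _ := [isSub for schwartz_family_fun].
HB.instance Definition _ := [Choice of schwartz_family by <:].
HB.instance Definition _ := [SubChoice_isSubLmodule of schwartz_family by <:].

Definition family_mul (f : 'rV[R]_m -> K) (v : 'rV[R]_m -> S') :
    'rV[R]_m -> S' :=
  fun p => f p *: v p.

End SchwartzFamilies.

(* Main.v *)
Require Import Defs.
From HB Require Import structures.
From mathcomp Require Import all_boot all_order all_algebra.
From mathcomp Require Import sesquilinear complex.
From mathcomp Require Import boolp classical_sets functions reals.
From mathcomp Require Import topology tvs normedtype derive.

Local Open Scope ring_scope.
Import GRing.Theory numFieldNormedType.Exports.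

Section FamilyMul.
Context {R : realType} {k : scalar_kind} {m n : nat}.
Local Notation K := (scalars R k).
Local Notation S' := (schwartz_dual R k n).
Implicit Types (f g : 'rV[R]_m -> K) (v w : 'rV[R]_m -> S') (c : K).

(** At each point [p] the product is the scalar [f p] acting on the vector [v p] of the dual space,
    so every identity is a vector space axiom read pointwise, for arbitrary functions and families.
    The analytic content is closure, [family_mul_schwartz]: testing the product on [phi] gives [f]
    times the Schwartz function [p |-> v p phi], and multipliers preserve Schwartz functions. *)

Lemma family_mul_linearl c f g v :
  family_mul (c *: f + g) v = c *: family_mul f v + family_mul g v.
Proof.
by apply/funext => p; rewrite /family_mul !fctE scalerDl -scalerA.
Qed.

Lemma family_mul_linearr c f v w :
  family_mul f (c *: v + w) = c *: family_mul f v + family_mul f w.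
Proof.
apply/funext => p; rewrite /family_mul !fctE scalerDr !scalerA.
by rewrite [f p * c]mulrC.
Qed.

Lemma family_mulDl f g v :
  family_mul (f + g) v = family_mul f v + family_mul g v.
(* Additivity is the case [c = 1] of linearity. *)
Proof. by rewrite -[f]scale1r family_mul_linearl !scale1r. Qed.

Lemma family_mulDr f v w :
  family_mul f (v + w) = family_mul f v + family_mul f w.
Proof. by rewrite -[v]scale1r family_mul_linearr !scale1r. Qed.

Lemma family_mul1 v : family_mul (fun=> 1) v = v.
Proof. by apply/funext => p; rewrite /family_mul scale1r. Qed.

End FamilyMul.

Section Product.
Context {R : realType} {k : scalar_kind} {m n : nat}.
Implicit Types (f : OM R k m) (v : schwartz_family R k m n).

(* (f v)(phi) is the function f multiplied by the Schwartz function v(phi). *)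
Lemma family_mul_schwartz f v :
  family_mul f v \in @schwartz_family_pred R k m n.
Proof.
apply/asboolP => phi.
have /asboolP Sv := valP v; have /asboolP[_ Sf] := valP f.
have vphi : (fun p => v p phi) \in @schwartz_pred R k m by exact/asboolP/Sv.
have := Sf (Schwartz vphi); congr is_schwartz.
by apply/funext => p /=; rewrite mulrC.
Qed.

Definition OM_mul f v : schwartz_family R k m n :=
  SchwartzFamily (family_mul_schwartz f v).

Lemma OM_mul_bilinear : bilinear_for *:%R *:%R OM_mul.
Proof.
(* Schwartz families are equal as soon as their underlying functions are, and the operations on [OM]
   and on families are the pointwise ones; this leaves the identities for plain functions. *)
split=> [v c f g|f c v w]; apply: val_inj.
  exact: family_mul_linearl.
exact: family_mul_linearr.
Qed.

(** Equips [OM_mul] with the bilinear structure that lets it serve as the witness [Phi]. *)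
HB.instance Definition _ := bilinear_isBilinear.Build _ _ _ _ _ _ OM_mul
  OM_mul_bilinear.

End Product.

Theorem mainTheorem2 (R : realType) (k : scalar_kind) (m n : nat)
    (hm : (1 <= m)%N) (hn : (1 <= n)%N) :
  (forall (f g : OM R k m) (v w : schwartz_family R k m n),
    [/\ family_mul (f + g) v = family_mul f v + family_mul g v,
        family_mul f (v + w) = family_mul f v + family_mul f w &
        family_mul (fun=> 1) v = v]) /\
  (exists Phi : {bilinear OM R k m -> schwartz_family R k m n ->
                   schwartz_family R k m n},
    forall (f : OM R k m) (v : schwartz_family R k m n),
      Phi f v = family_mul f v :> ('rV[R]_m -> schwartz_dual R k n)).
Proof.
split=> [f g v w|].
  by split; [exact: family_mulDl|exact: family_mulDr|exact: family_mul1].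
by exists OM_mul.
Qed.
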